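(* Let $K$ be a finite-dimensional Kac algebra obtained by twisting a group algebra $\mathbb{C}[G]$ with a 2-(pseudo)-cocycle $\Omega$ of a commutative subgroup $H$ of $G$. The intrinsic group $G(K)$ of $K$ contains $H$. Therefore, its group algebra (the linear span of $G(K)$ in $K$) coincides with the algebra of the subgroup $G'$ of those elements $g$ of $G$ such that $\Delta(\lambda(g))$ is symmetric.
   Context: A finite-dimensional Kac algebra is a finite-dimensional $C^*$-algebra $K$ with a Hopf algebra structure $(\Delta,\varepsilon,S)$ for which $\Delta$ is a $*$-homomorphism. The intrinsic group $G(K)$ is the group of invertible $x\in K$ with $\Delta(x)=x\otimes x$. Twisting: $G$ is a finite group, $\lambda(g)$ is the canonical basis of $\mathbb{C}[G]$, $\Delta_s(\lambda(g))=\lambda(g)\otimes\lambda(g)$, and $H$ is a commutative subgroup (identified with $\{\lambda(h)\}$). $\Omega$ is a unitary of $\mathbb{C}[H]\otimes\mathbb{C}[H]$ such that the $*$-algebra $\mathbb{C}[G]$ with the coproduct $\Delta(x)=\Omega\Delta_s(x)\Omega^*$ and the usual counit is a Kac algebra $K$ (in particular $\Delta$ is coassociative); one says that $K$ is obtained by twisting $\mathbb{C}[G]$ with $\Omega$. An element of $K\otimes K$ is symmetric if it is fixed by the flip $x\otimes y\mapsto y\otimes x$. *)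

(* Defs.v *)
From HB Require Import structures.
From mathcomp Require Import all_boot all_order all_fingroup all_algebra all_field.
From mathcomp Require Import reals complex.

Set Implicit Arguments.
Unset Strict Implicit.
Unset Printing Implicit Defensive.

Import GRing.Theory Num.Theory VectorInternalTheory.
Local Open Scope ring_scope.

Reserved Notation "x ⊗ y" (at level 40, left associativity).

Section TensorProduct.
Variable F : fieldType.

(* The tensor product of two finite-dimensional spaces: the (i, j) entry of a
   matrix is the coefficient of e_i ⊗ f_j, where (e_i) and (f_j) are the bases
   underlying the coordinate maps [v2r] of A and B. *)
Definition tens (A B : vectType F) : Type := 'M[F]_(dim A, dim B).

HB.instance Definition _ (A B : vectType F) :=
  Vector.on (tens A B).

Definition tpure (A B : vectType F) (x : A) (y : B) : tens A B :=
  (v2r x)^T *m v2r y.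
Local Notation "x ⊗ y" := (tpure x y).

Definition vunit (A : vectType F) (i : 'I_(dim A)) : A := r2v (delta_mx 0 i).

(* The linear map A ⊗ B -> V induced by a bilinear map, see [tlift_pure]. *)
Definition tlift (A B : vectType F) (V : lmodType F) (b : A -> B -> V)
    (z : tens A B) : V :=
  \sum_i \sum_j z i j *: b (vunit i) (vunit j).

Definition bilin (U V : lmodType F) (W : lmodType F) (b : U -> V -> W) :=
  (forall v, linear (b^~ v)) /\ (forall u, linear (b u)).

Lemma vunit_sum (A : vectType F) (x : A) : x = \sum_i v2r x 0 i *: vunit i.
Proof.
apply: v2r_inj; rewrite linear_sum /= {1}[v2r x]row_sum_delta.
by apply: eq_bigr => i _; rewrite linearZ /= r2vK.
Qed.

Lemma tpure_bilin (A B : vectType F) : bilin (@tpure A B).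
Proof.
split=> [y a x x'|x a y y']; rewrite /tpure !linearP.
  by rewrite mulmxDl -scalemxAl.
by [].
Qed.

Lemma tlift_linear (A B : vectType F) (V : lmodType F) (b : A -> B -> V) :
  linear (tlift b).
Proof.
move=> a z z'; rewrite /tlift scaler_sumr -big_split; apply: eq_bigr => i _ /=.
rewrite scaler_sumr -big_split; apply: eq_bigr => j _ /=.
by rewrite !mxE scalerDl scalerA.
Qed.

Lemma tlift_pure (A B : vectType F) (V : lmodType F) (b : A -> B -> V) :
  bilin b -> forall x y, tlift b (x ⊗ y) = b x y.
Proof.
move=> [bl br] x y.
have sl I (r : seq I) (c : I -> F) (u : I -> A) v :
  b (\sum_(i <- r) c i *: u i) v = \sum_(i <- r) c i *: b (u i) v.
  have b0 : b 0 v = 0 by have := bl v (-1) 0 0; rewrite scaler0 addr0 scaleN1r addNr.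
  by elim: r => [|i r IH]; rewrite ?big_nil // !big_cons bl IH.
have sr I (r : seq I) (c : I -> F) u (v : I -> B) :
  b u (\sum_(i <- r) c i *: v i) = \sum_(i <- r) c i *: b u (v i).
  have b0 : b u 0 = 0 by have := br u (-1) 0 0; rewrite scaler0 addr0 scaleN1r addNr.
  by elim: r => [|i r IH]; rewrite ?big_nil // !big_cons br IH.
rewrite {2}[x]vunit_sum {2}[y]vunit_sum sl; apply: eq_bigr => i _.
rewrite sr scaler_sumr; apply: eq_bigr => j _.
by rewrite mxE big_ord1 mxE scalerA.
Qed.

Lemma tens_sum (A B : vectType F) (z : tens A B) :
  z = \sum_i \sum_j z i j *: (vunit i ⊗ vunit j).
Proof.
rewrite {1}[z : 'M__]matrix_sum_delta; apply: eq_bigr => i _.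
apply: eq_bigr => j _; congr (_ *: _).
by rewrite /tpure /vunit !r2vK trmx_delta mul_delta_mx.
Qed.

Lemma tens_ind (A B : vectType F) (P : tens A B -> Prop) :
  P 0 -> (forall z z', P z -> P z' -> P (z + z')) ->
  (forall x y, P (x ⊗ y)) -> forall z, P z.
Proof.
move=> P0 PD Pp z; rewrite [z]tens_sum.
apply: (big_ind P) => // i _; apply: (big_ind P) => // j _.
suff -> : z i j *: (vunit i ⊗ vunit j) = (z i j *: vunit i) ⊗ vunit j by [].
by rewrite /tpure !linearZ /= -scalemxAl.
Qed.

Lemma tlift_lc (A B : vectType F) (V : lmodType F) (b b1 b2 : A -> B -> V) a z :
  (forall x y, b x y = a *: b1 x y + b2 x y) ->
  tlift b z = a *: tlift b1 z + tlift b2 z.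
Proof.
move=> Eb; rewrite /tlift scaler_sumr -big_split; apply: eq_bigr => i _ /=.
rewrite scaler_sumr -big_split; apply: eq_bigr => j _ /=.
by rewrite Eb scalerDr !scalerA mulrC.
Qed.

Definition tmap (A B A' B' : vectType F) (f : A -> A') (g : B -> B') :
  tens A B -> tens A' B' := tlift (fun x y => f x ⊗ g y).

Definition tflip (A B : vectType F) : tens A B -> tens B A :=
  tlift (fun x y => y ⊗ x).

Definition tassoc (A B D : vectType F) :
    tens (tens A B) D -> tens A (tens B D) :=
  tlift (fun w z => tlift (fun x y => x ⊗ (y ⊗ z)) w).

End TensorProduct.
Notation "x ⊗ y" := (tpure x y) : ring_scope.

Section TensorAlgebra.
Variables (F : fieldType) (A B : falgType F).
Local Notation T := (tens A B).

Definition tone : T := 1 ⊗ 1.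

(* (a ⊗ b) * (c ⊗ d) = (a * c) ⊗ (b * d), see [tmul_pure]. *)
Definition tmul (z w : T) : T :=
  tlift (fun a b => tlift (fun c d => (a * c) ⊗ (b * d)) w) z.

Let inner_bilin (a : A) (b : B) :
  bilin (fun c d => (a * c) ⊗ (b * d) : T).
Proof.
have [tl tr] := tpure_bilin A B.
by split=> [v k u u'|u k v v']; rewrite mulrDr -scalerAr ?tl ?tr.
Qed.

Let outer_bilin (w : T) :
  bilin (fun a b => tlift (fun c d => (a * c) ⊗ (b * d) : T) w).
Proof.
have [tl tr] := tpure_bilin A B.
by split=> [v k u u'|u k v v']; apply: tlift_lc => x y;
  rewrite mulrDl -scalerAl ?tl ?tr.
Qed.

Lemma tmul_pure a b c d : tmul (a ⊗ b) (c ⊗ d) = (a * c) ⊗ (b * d).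
Proof. by rewrite /tmul tlift_pure // tlift_pure. Qed.

Let tmul_linl w : linear (tmul^~ w).
Proof. exact: tlift_linear. Qed.

Let tmul_linr z : linear (tmul z).
Proof. by move=> k u v; apply: tlift_lc => x y; apply: tlift_linear. Qed.

Let tmulDl : left_distributive tmul +%R.
Proof. by move=> u v w; have := tmul_linl w 1 u v; rewrite !scale1r. Qed.

Let tmulDr : right_distributive tmul +%R.
Proof. by move=> u v w; have := tmul_linr u 1 v w; rewrite !scale1r. Qed.

Let tmul0l z : tmul 0 z = 0.
Proof. by apply: (addrI (tmul 0 z)); rewrite -tmulDl !addr0. Qed.

Let tmul0r z : tmul z 0 = 0.
Proof. by apply: (addrI (tmul z 0)); rewrite -tmulDr !addr0. Qed.

Let tmulA : associative tmul.
Proof.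
move=> u v w.
elim/tens_ind: u => [|u u' Hu Hu'|a b]; rewrite ?tmul0l ?tmulDl ?Hu ?Hu' //.
elim/tens_ind: v => [|v v' Hv Hv'|c d];
  rewrite ?(tmul0l, tmul0r) ?(tmulDl, tmulDr) ?Hv ?Hv' //.
elim/tens_ind: w => [|w w' Hw Hw'|e f];
  rewrite ?(tmul0l, tmul0r) ?(tmulDl, tmulDr) ?Hw ?Hw' //.
by rewrite !tmul_pure !mulrA.
Qed.

Let tmul1l : left_id tone tmul.
Proof.
elim/tens_ind => [|u u' Hu Hu'|a b]; rewrite ?tmul0r ?tmulDr ?Hu ?Hu' //.
by rewrite tmul_pure !mul1r.
Qed.

Let tmul1r : right_id tone tmul.
Proof.
elim/tens_ind => [|u u' Hu Hu'|a b]; rewrite ?tmul0l ?tmulDl ?Hu ?Hu' //.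
by rewrite tmul_pure !mulr1.
Qed.

Let tone_neq0 : tone != 0.
Proof.
have nz (D : falgType F) : exists i, v2r (1 : D) 0 i != 0.
  apply/rV0Pn; apply: contra_neq (oner_neq0 D) => v0.
  by apply: v2r_inj; rewrite v0 linear0.
have [[i ai] [j bj]] := (nz A, nz B).
apply: contraNneq (mulf_neq0 ai bj) => /matrixP/(_ i j).
by rewrite /tone /tpure !mxE big_ord1 mxE => ->.
Qed.

HB.instance Definition _ := GRing.Zmodule_isNzRing.Build T
  tmulA tmul1l tmul1r tmulDl tmulDr tone_neq0.

Let tscaleAl (k : F) (u v : T) : k *: (u * v) = (k *: u) * v.
Proof. by have := tmul_linl v k u 0; rewrite !addr0 tmul0l addr0 => /esym. Qed.
HB.instance Definition _ := GRing.Lmodule_isLalgebra.Build F T tscaleAl.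

Let tscaleAr (k : F) (u v : T) : k *: (u * v) = u * (k *: v).
Proof. by have := tmul_linr u k v 0; rewrite !addr0 tmul0r addr0 => /esym. Qed.
HB.instance Definition _ := GRing.Lalgebra_isAlgebra.Build F T tscaleAr.
HB.instance Definition _ := Algebra_isFalgebra.Build F T.

End TensorAlgebra.

Section KacAlgebra.
Variable C : numClosedFieldType.

(* The conjugate-linear map x ⊗ y |-> (star x) ⊗ (star y). *)
Definition tstar (A : vectType C) (star : A -> A) (z : tens A A) : tens A A :=
  \sum_i \sum_j (z i j)^* *: (star (vunit i) ⊗ star (vunit j)).

Definition star_algebra (A : falgType C) (star : A -> A) : Prop :=
  [/\ forall a x y, star (a *: x + y) = a^* *: star x + star y,
      forall x y, star (x * y) = star y * star x
    & involutive star].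

(* As with [`|_|] on a [numDomainType], the norm takes its values in the
   nonnegative reals of C. Completeness is automatic in finite dimension. *)
Definition cstar_norm (A : falgType C) (star : A -> A) (N : A -> C) : Prop :=
  [/\ forall x, 0 <= N x /\ (N x = 0 -> x = 0),
      forall x y, N (x + y) <= N x + N y,
      forall a x, N (a *: x) = `|a| * N x,
      forall x y, N (x * y) <= N x * N y
    & forall x, N (star x * x) = N x ^+ 2].

Record kac_algebra (A : falgType C) := KacAlgebra {
  kstar : A -> A;
  kcomul : {lrmorphism A -> tens A A};
  kcounit : {lrmorphism A -> C^o};
  kantipode : {linear A -> A};
  kstarP : star_algebra kstar;
  kcstarP : exists N, cstar_norm kstar N;
  kcomulA : forall x,
    tassoc (tmap kcomul idfun (kcomul x)) = tmap idfun kcomul (kcomul x);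
  kcounitl : forall x, tlift (fun y z => kcounit y *: z) (kcomul x) = x;
  kcounitr : forall x, tlift (fun y z => kcounit z *: y) (kcomul x) = x;
  kantipodel : forall x,
    tlift (fun y z => kantipode y * z) (kcomul x) = (kcounit x)%:A;
  kantipoder : forall x,
    tlift (fun y z => y * kantipode z) (kcomul x) = (kcounit x)%:A;
  kcomul_star : forall x, kcomul (kstar x) = tstar kstar (kcomul x)
}.

Definition intrinsic_group (A : falgType C) (K : kac_algebra A) (x : A) : Prop :=
  x \is a GRing.unit /\ kcomul K x = x ⊗ x.

Lemma tstar_pure (A : falgType C) (star : A -> A) : star_algebra star ->
  forall x y, tstar star (x ⊗ y) = star x ⊗ star y.
Proof.
move=> [starD _ _] x y; have [tl tr] := tpure_bilin A A.
have star0 : star 0 = 0.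
  by have := starD (-1) 0 0; rewrite scaler0 addr0 rmorphN1 scaleN1r addNr.
have tl0 v : (0 : A) ⊗ v = 0 :> tens A A by rewrite /tpure !linear0 mul0mx.
have tr0 u : u ⊗ (0 : A) = 0 :> tens A A by rewrite /tpure !linear0.
have st n (c : 'I_n -> C) (u : 'I_n -> A) :
    star (\sum_i c i *: u i) = \sum_i (c i)^* *: star (u i).
  apply: (big_rec2 (fun p q => star p = q)) => [|i p q _ <-].
    exact: star0.
  exact: starD.
have sl n (c : 'I_n -> C) (u : 'I_n -> A) (v : A) :
    (\sum_i c i *: u i) ⊗ v = \sum_i c i *: (u i ⊗ v).
  apply: (big_rec2 (fun p q => p ⊗ v = q)) => [|i p q _ <-].
    exact: tl0.
  exact: tl.
have sr n (c : 'I_n -> C) (u : 'I_n -> A) (v : A) :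
    v ⊗ (\sum_i c i *: u i) = \sum_i c i *: (v ⊗ u i).
  apply: (big_rec2 (fun p q => v ⊗ p = q)) => [|i p q _ <-].
    exact: tr0.
  exact: tr.
rewrite {2}[x]vunit_sum {2}[y]vunit_sum !st sl; apply: eq_bigr => i _.
rewrite sr scaler_sumr; apply: eq_bigr => j _.
by rewrite mxE big_ord1 mxE scalerA rmorphM.
Qed.

End KacAlgebra.

Definition in_span (F : fieldType) (V : vectType F) (P : V -> Prop) (x : V) :=
  exists2 s : seq V, forall y, y \in s -> P y & x \in <<s>>%VS.

Section GroupAlgebra.
Variables (F : fieldType) (gT : finGroupType).

Definition galg : Type := {ffun gT -> F^o}.
HB.instance Definition _ := Vector.on galg.

Definition glambda (g : gT) : galg := [ffun x => (x == g)%:R].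

Definition gone : galg := glambda 1%g.
Definition gmul (x y : galg) : galg :=
  [ffun g => \sum_h x h * y (h^-1 * g)%g].

Let gmulA : associative gmul.
Proof.
move=> x y z; apply/ffunP => g; rewrite !ffunE.
under [RHS]eq_bigr => h _ do rewrite ffunE mulr_suml.
rewrite exchange_big /=; apply: eq_bigr => k _.
rewrite ffunE mulr_sumr (reindex_inj (mulgI k^-1%g)) /=.
by apply: eq_bigr => h _; rewrite mulrA invMg invgK !mulgA mulgK.
Qed.

Let gmul1l : left_id gone gmul.
Proof.
move=> x; apply/ffunP => g; rewrite ffunE (bigD1 1%g) //= big1 => [|h /negPf nh].
  by rewrite ffunE eqxx mul1r invg1 mul1g addr0.
by rewrite ffunE nh mul0r.
Qed.

Let gmul1r : right_id gone gmul.
Proof.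
move=> x; apply/ffunP => g; rewrite ffunE (bigD1 g) //= big1 => [|h nh].
  by rewrite ffunE mulVg eqxx mulr1 addr0.
by rewrite ffunE -eq_mulVg1 (negPf nh) mulr0.
Qed.

Let gmulDl : left_distributive gmul +%R.
Proof.
move=> x y z; apply/ffunP => g; rewrite !ffunE -big_split.
by apply: eq_bigr => h _; rewrite ffunE mulrDl.
Qed.

Let gmulDr : right_distributive gmul +%R.
Proof.
move=> x y z; apply/ffunP => g; rewrite !ffunE -big_split.
by apply: eq_bigr => h _; rewrite ffunE mulrDr.
Qed.

Let gone_neq0 : gone != 0.
Proof.
by apply/eqP => /ffunP/(_ 1%g)/eqP; rewrite !ffunE eqxx oner_eq0.
Qed.

HB.instance Definition _ := GRing.Zmodule_isNzRing.Build galg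
  gmulA gmul1l gmul1r gmulDl gmulDr gone_neq0.

Let gscaleAl (k : F) (x y : galg) : k *: (x * y) = (k *: x) * y.
Proof.
apply/ffunP => g; rewrite !ffunE scaler_sumr.
by apply: eq_bigr => h _; rewrite ffunE scalerAl.
Qed.
HB.instance Definition _ := GRing.Lmodule_isLalgebra.Build F galg gscaleAl.

Let gscaleAr (k : F) (x y : galg) : k *: (x * y) = x * (k *: y).
Proof.
apply/ffunP => g; rewrite !ffunE scaler_sumr.
by apply: eq_bigr => h _; rewrite ffunE scalerAr.
Qed.
HB.instance Definition _ := GRing.Lalgebra_isAlgebra.Build F galg gscaleAr.
HB.instance Definition _ := Algebra_isFalgebra.Build F galg.

Lemma glambdaM g h : glambda g * glambda h = glambda (g * h)%g.
Proof.
apply/ffunP => k; rewrite ffunE (bigD1 g) //= big1 => [|l /negPf nl].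
  by rewrite !ffunE eqxx mul1r addr0 (can2_eq (mulKVg g) (mulKg g)).
by rewrite ffunE nl mul0r.
Qed.

Definition gcomul (x : galg) : tens galg galg :=
  \sum_g x g *: (glambda g ⊗ glambda g).

Definition gcounit (x : galg) : F := \sum_g x g.

Definition galg_on (S : {set gT}) : {vspace galg} :=
  <<[seq glambda g | g <- enum S]>>%VS.

Definition galg2_on (S : {set gT}) : {vspace (tens galg galg)} :=
  <<[seq glambda g ⊗ glambda h | g <- enum S, h <- enum S]>>%VS.

End GroupAlgebra.

Section Twisting.
Variables (C : numClosedFieldType) (gT : finGroupType).
Local Notation CG := (galg C gT).

(* The conjugate-linear involution with lambda(g)^* = lambda(g^-1). *)
Definition gstar (x : CG) : CG := [ffun g => (x g^-1%g)^*].

(* K is C[gT] with its usual *-algebra structure and counit and with the coproduct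
   Omega (gcomul x) Omega^*; its antipode is determined by the other data. *)
Record twisting (H : {group gT}) (Omega : tens CG CG) (K : kac_algebra CG) :
    Prop := Twisting {
  twist_in : Omega \in galg2_on C H;
  twist_unitaryl : tstar gstar Omega * Omega = 1;
  twist_unitaryr : Omega * tstar gstar Omega = 1;
  twist_star : forall x, kstar K x = gstar x;
  twist_counit : forall x, kcounit K x = gcounit x;
  twist_comul : forall x,
    kcomul K x = Omega * gcomul x * tstar gstar Omega
}.

(* The set G' of the g such that Delta(lambda(g)) is symmetric. *)
Definition symmetric_part (K : kac_algebra CG) : {set gT} :=
  [set g | tflip (kcomul K (glambda C g)) == kcomul K (glambda C g)].

End Twisting.

(* Main.v *)
Require Import Defs.
From HB Require Import structures.
From mathcomp Require Import all_boot all_order all_fingroup all_algebra all_field.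
From mathcomp Require Import reals complex.
From mathcomp Require Import mxred.

Set Implicit Arguments.
Unset Strict Implicit.
Unset Printing Implicit Defensive.

Import GRing.Theory Num.Theory.
Local Open Scope ring_scope.
Local Open Scope sesquilinear_scope.

(** Write Delta for the twisted coproduct, lambda for the canonical basis, and
    G' for the set of the g such that Delta (lambda g) is symmetric.

    H is contained in the intrinsic group because Omega commutes with
    lambda h ⊗ lambda h, so that conjugation by Omega does nothing to it.
    G' is a group because the flip is multiplicative.

    The span of the intrinsic group lies in C[G'] ([grouplike_supported]). For
    x group-like, undoing the twist writes sum_g x(g) lambda(g) ⊗ lambda(g) as
    Omega^* (x ⊗ x) Omega, a combination of elements p ⊗ q whose right factors
    q = lambda(b) x lambda(b'), with b and b' in H, are again group-like.
    Slicing the left leg at g shows that x(g) lambda(g) is a combination of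
    group-likes. Since Delta is symmetric on group-likes, g is in G' as soon as
    x(g) != 0.

    Conversely, C[G'] is spanned by group-likes ([symmetric_part_spanned]).
    Omega lies in C[G'] ⊗ C[G'], so that Delta restricts to C[G'], and there it
    is cocommutative: what remains is that a cocommutative finite-dimensional
    Kac algebra is spanned by its group-likes ([grouplikes_span]). The slice
    operators R_l = (id ⊗ delta_l) Delta, for l in G', commute by coassociativity
    and cocommutativity. The coefficient at 1 is an invariant trace
    ([haar_coef]), so that V : x ⊗ y |-> Delta(x) (1 ⊗ y) is unitary on
    L^2(G' x G'). Its slices being the R_l, it commutes with R_n ⊗ 1, hence so
    does its adjoint, whose slices are the adjoints of the R_l. In particular
    each R_l is normal, and the R_l have a common eigenbasis. If v is a common
    eigenvector then Delta(v) = v ⊗ w for some w, and the counit gives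
    v = epsilon(v) w, so that w is group-like. It is invertible because the
    antipode provides the inverse. *)

(** * Matrices indexed by a finite type *)

Section Kernels.

Definition kernel_mx (F : nzRingType) (T : finType) (f : T -> T -> F) :
    'M[F]_#|T| :=
  \matrix_(i, j) f (enum_val i) (enum_val j).

Lemma kernel_mxM (F : nzRingType) (T : finType) (f g : T -> T -> F) :
  kernel_mx f *m kernel_mx g = kernel_mx (fun x z => \sum_y f x y * g y z).
Proof.
apply/matrixP => i k; rewrite !mxE [RHS](reindex (enum_val : 'I_#|T| -> T)) /=.
  by apply: eq_bigr => j _; rewrite !mxE.
exact/onW_bij/enum_val_bij.
Qed.

Lemma kernel_mxE (F : nzRingType) (T : finType) (f : T -> T -> F) x y :
  kernel_mx f (enum_rank x) (enum_rank y) = f x y.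
Proof. by rewrite mxE !enum_rankK. Qed.

Lemma eq_kernel_mx (F : nzRingType) (T : finType) (f g : T -> T -> F) :
  f =2 g -> kernel_mx f = kernel_mx g.
Proof. by move=> E; apply/matrixP => i j; rewrite !mxE E. Qed.

Lemma kernel_mx_inj (F : nzRingType) (T : finType) (f g : T -> T -> F) :
  kernel_mx f = kernel_mx g -> f =2 g.
Proof. by move=> E x y; rewrite -kernel_mxE E kernel_mxE. Qed.

Lemma kernel_mx1 (F : nzRingType) (T : finType) :
  kernel_mx (fun x y : T => (x == y)%:R) = 1%:M :> 'M[F]_#|T|.
Proof. by apply/matrixP => i j; rewrite !mxE (inj_eq enum_val_inj). Qed.

Lemma kernel_mx_adjoint (C : numClosedFieldType) (T : finType) (f : T -> T -> C) :
  (kernel_mx f)^t* = kernel_mx (fun x y => (f y x)^*).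
Proof. by apply/matrixP => i j; rewrite !mxE. Qed.

Lemma normal_diagonalizable (C : numClosedFieldType) n (A : 'M[C]_n) :
  A \is normalmx -> diagonalizable A.
Proof.
move/orthomx_spectralP ->; exists (spectralmx A); first exact: spectral_unit.
apply/similar_diagLR; first exact: spectral_unit.
by exists (spectral_diag A); rewrite conjVmx ?spectral_unit.
Qed.

Lemma sum_pair_delta (F : nzRingType) (T U : finType) (m : U) (f : T * U -> F) :
  \sum_p f p * (p.2 == m)%:R = \sum_x f (x, m).
Proof.
transitivity (\sum_x \sum_y f (x, y) * (y == m)%:R).
  by rewrite pair_bigA; apply: eq_bigr => -[].
apply: eq_bigr => x _.
rewrite (bigD1 m) //= eqxx mulr1 big1 ?addr0 // => y /negPf ->.
by rewrite mulr0.
Qed.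

End Kernels.

(** * Group-likes of a cocommutative Kac structure on a group algebra *)

(** Here [c g k l] is the coefficient of lambda k ⊗ lambda l in the coproduct of
    lambda g, so that the hypotheses are the coordinate form of coassociativity,
    cocommutativity, the left counit axiom, multiplicativity and
    *-compatibility of the coproduct, and of the invariance
    (tau ⊗ id) Delta = tau(.) 1 of the trace tau(x) = x(1). *)
Section CocommutativeGroupAlgebra.
Variables (C : numClosedFieldType) (gT : finGroupType).
Variable c : gT -> gT -> gT -> C.

Hypothesis coassoc : forall g k l n,
  \sum_m c g m n * c m k l = \sum_m c g k m * c m l n.
Hypothesis cocomm : forall g k l, c g k l = c g l k.
Hypothesis counit : forall g l, \sum_k c g k l = (g == l)%:R.
Hypothesis comulM : forall g g' k l,
  c (g * g')%g k l = \sum_a \sum_b c g a b * c g' (a^-1 * k)%g (b^-1 * l)%g.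
Hypothesis comul_star : forall g k l, (c g k l)^* = c g^-1%g k^-1%g l^-1%g.
Hypothesis haar : forall g l, c g 1%g l = ((g == 1%g) && (l == 1%g))%:R.

(* The matrix of x |-> (id ⊗ delta_l) Delta(x), acting on row vectors. *)
Let coaction l := kernel_mx (fun g k => c g k l).

Lemma coactionC l n : coaction l *m coaction n = coaction n *m coaction l.
Proof.
rewrite !kernel_mxM; apply: eq_kernel_mx => g k.
have -> : \sum_m c g m l * c m k n = \sum_m c g k m * c m n l by exact: coassoc.
by rewrite coassoc; apply: eq_bigr => m _; rewrite (cocomm m l).
Qed.

(* The row (g, h) holds the coefficients of
   Delta(lambda g) (1 ⊗ lambda h): this is the Kac-Takesaki operator. *)
Let fundamental (p q : gT * gT) : C := c p.1 q.1 (q.2 * p.2^-1)%g.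

(** The inner product of Delta(x) (1 ⊗ y) and Delta(x') (1 ⊗ y') is the value of
    tau ⊗ tau at Delta(x'^* x) (1 ⊗ y y'^* ), which the invariance of tau turns
    into tau(x'^* x) tau(y'^* y). *)
Lemma fundamental_unitary : kernel_mx fundamental *m (kernel_mx fundamental)^t* = 1%:M.
Proof.
rewrite kernel_mx_adjoint kernel_mxM -kernel_mx1.
apply: eq_kernel_mx => -[g h] [g' h'].
transitivity (c (g'^-1 * g)%g 1%g (h' * h^-1)%g).
  (* The star turns the conjugated coefficient at (k, l h'^-1) into a plain one
     at the inverse indices. *)
  rewrite comulM pair_bigA /=.
  rewrite [RHS](reindex (fun p : gT * gT => (p.1^-1, h' * p.2^-1)%g)) /=.
    apply: eq_bigr => -[k l] _; rewrite /fundamental /= comul_star mulrC.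
    by rewrite !invMg !invgK !mulg1 !mulgA mulgKV.
  exists (fun p : gT * gT => (p.1^-1, p.2^-1 * h')%g) => -[k l] _ /=.
    by rewrite !invMg !invgK mulgKV.
  by rewrite !invMg !invgK mulKVg.
by rewrite haar -eq_mulVg1 -eq_mulgV1 [g' == g]eq_sym [h' == h]eq_sym xpair_eqE.
Qed.

(** The fundamental operator V commutes with B = R_l ⊗ 1, because its slices are
    coaction matrices. It is unitary, so its adjoint commutes with B as well,
    and the adjoint of R_l is one of the slices of the adjoint of V. *)
Lemma coaction_normal l : coaction l \is normalmx.
Proof.
pose V := kernel_mx fundamental.
pose B := kernel_mx (fun p q : gT * gT => c p.1 q.1 l * (p.2 == q.2)%:R).
have VB : V *m B = B *m V.
  rewrite !kernel_mxM; apply: eq_kernel_mx => -[g h] [k m] /=.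
  have := coactionC (m * h^-1)%g l; rewrite !kernel_mxM => /kernel_mx_inj/(_ g k).
  under [\sum_y fundamental _ y * _]eq_bigr do rewrite mulrA.
  under [\sum_y _ * fundamental _ _]eq_bigr do rewrite mulrAC eq_sym.
  by rewrite !sum_pair_delta.
have V1 : V^t* *m V = 1%:M by apply: mulmx1C; exact: fundamental_unitary.
have VaB : V^t* *m B = B *m V^t*.
  rewrite -[LHS]mulmx1 -fundamental_unitary -/V mulmxA -(mulmxA _ B) -VB.
  by rewrite !mulmxA V1 mul1mx.
apply/normalmxP; move: VaB; rewrite !kernel_mx_adjoint !kernel_mxM => /kernel_mx_inj E.
apply: eq_kernel_mx => g k.
(* The entries with second indices l and 1 are those of the slice at l. *)
move/esym: (E (g, l) (k, 1%g)) => /=.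
under eq_bigr do rewrite mulrAC eq_sym.
under [\sum_y (fundamental _ _)^* * _]eq_bigr do rewrite mulrA.
by rewrite !sum_pair_delta /fundamental /= invg1 mulg1.
Qed.

(** The [w i] are the coordinates of the group-likes: common eigenvectors of
    the coaction matrices, normalized to have counit 1. *)
Lemma grouplikes_span :
  exists w : 'I_#|gT| -> gT -> C,
    [/\ forall i, \sum_g w i g = 1,
        forall i k l, \sum_g w i g * c g k l = w i k * w i l
      & forall g, exists q : 'I_#|gT| -> C,
          forall k, (k == g)%:R = \sum_i q i * w i k].
Proof.
pose Rs := [seq coaction l | l <- enum gT].
have [|P Pu /allP /= PD] := (@codiagonalizableP _ _ Rs).1.
  split=> [_ _ /mapP[l _ ->] /mapP[n _ ->]|_ /mapP[l _ ->]].
    exact: coactionC.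
  exact/normal_diagonalizable/coaction_normal.
pose p i g := P i (enum_rank g); pose e i := \sum_k p i k.
(* For an eigenvector p with counit e: e Delta(p) = p ⊗ p. *)
have pE i k l : e i * \sum_g p i g * c g k l = p i k * p i l.
  have /PD/similar_diagPex[d /(similarP Pu)/matrixP E] :
      coaction l \in Rs.
    by apply: map_f; rewrite mem_enum.
  have {}E n : \sum_g p i g * c g n l = d 0 i * p i n.
    have := E i (enum_rank n); rewrite mul_diag_mx !mxE => <-.
    rewrite (reindex (enum_val : 'I_#|gT| -> gT)) /=.
      by apply: eq_bigr => j _; rewrite /p enum_valK mxE enum_rankK.
    exact/onW_bij/enum_val_bij.
  (* Summing the eigenvalue equation against the counit. *)
  have -> : p i l = d 0 i * e i.
    rewrite mulr_sumr; under eq_bigr do rewrite -E.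
    rewrite exchange_big /=; under eq_bigr do rewrite -mulr_sumr counit.
    rewrite (bigD1 l) //= eqxx mulr1 big1 ?addr0 // => g /negPf ->.
    by rewrite mulr0.
  by rewrite E mulrCA mulrA mulrC mulrA.
(* Otherwise pE would make the whole row of the invertible matrix P vanish. *)
have e0 i : e i != 0.
  apply/eqP => ei0; move: Pu.
  have p0 l : p i l = 0.
    by have /eqP := pE i l l; rewrite ei0 mul0r eq_sym mulf_eq0 orbb => /eqP.
  rewrite unitmxE (expand_det_row _ i) big1 ?unitr0 // => j _.
  by have := p0 (enum_val j); rewrite /p enum_valK => ->; rewrite mul0r.
exists (fun i g => p i g / e i); split=> [i|i k l|g].
- by rewrite -mulr_suml mulfV ?e0.
- transitivity ((\sum_g p i g * c g k l) / e i).
    by rewrite mulr_suml; apply: eq_bigr => g _; rewrite mulrAC.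
  apply: (mulfI (e0 i)).
  by rewrite mulrA pE mulrACA mulrA mulrCA mulfV ?mulr1 // mulrA.
exists (fun i => invmx P (enum_rank g) i * e i) => k.
have /matrixP/(_ (enum_rank g) (enum_rank k)) := mulVmx Pu.
rewrite !mxE (inj_eq enum_rank_inj) eq_sym => <-; apply: eq_bigr => i _.
by rewrite [RHS]mulrACA mulfV ?mulr1.
Qed.

End CocommutativeGroupAlgebra.

(** * Coordinates on the tensor square of a group algebra *)

Section Tensors.
Variable F : fieldType.

Lemma linear_sum_scale (U V : lmodType F) (f : U -> V) I (r : seq I) (a : I -> F)
    (u : I -> U) :
  linear f -> f (\sum_(i <- r) a i *: u i) = \sum_(i <- r) a i *: f (u i).
Proof.
move=> lf; have f0 : f 0 = 0.
  by have := lf (-1) 0 0; rewrite scaler0 addr0 scaleN1r addNr.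
by elim: r => [|i r IH]; rewrite ?big_nil // !big_cons lf IH.
Qed.

Lemma linear_tlift (A B : vectType F) (V W : lmodType F) (f : V -> W)
    (b : A -> B -> V) z :
  linear f -> f (tlift b z) = tlift (fun x y => f (b x y)) z.
Proof.
move=> lf.
have fD v w : f (v + w) = f v + f w by rewrite -[v]scale1r lf !scale1r.
have f0 : f 0 = 0 by apply: (addrI (f 0)); rewrite -fD !addr0.
rewrite /tlift; apply: (big_rec2 (fun v w => f v = w)) => // i v w _ <-.
by rewrite fD linear_sum_scale.
Qed.

Lemma eq_tlift (A B : vectType F) (V : lmodType F) (b b' : A -> B -> V) z :
  (forall x y, b x y = b' x y) -> tlift b z = tlift b' z.
Proof. by move=> E; apply: eq_bigr => i _; apply: eq_bigr => j _; rewrite E. Qed.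

Lemma tflip_pure (A B : vectType F) (x : A) (y : B) : tflip (x ⊗ y) = y ⊗ x.
Proof.
have [tl tr] := tpure_bilin B A.
by rewrite /tflip tlift_pure //; split=> [v k u u'|u k v v']; rewrite ?tl ?tr.
Qed.

Variable gT : finGroupType.
Local Notation A := (galg F gT).
Local Notation lam := (@glambda F gT).
Implicit Types (x y : A) (z w : tens A A).

Lemma galg_sum (x : A) : x = \sum_g x g *: lam g.
Proof.
apply/ffunP => k; rewrite sum_ffunE (bigD1 k) //= big1 => [|g ng].
  by rewrite !ffunE eqxx [_ *: _]mulr1 addr0.
by rewrite !ffunE eq_sym (negPf ng) scaler0.
Qed.

Definition tcoef (z : tens A A) (k l : gT) : F :=
  tlift (fun x y => x k * y l : F^o) z.

Lemma coef_bilin k l : bilin (fun x y : A => x k * y l : F^o).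
Proof.
split=> [y a x x'|x a y y']; rewrite !ffunE.
  by rewrite mulrDl -scalerAl.
by rewrite mulrDr -scalerAr.
Qed.

Lemma tcoef_linear k l : linear ((fun z => tcoef z k l) : _ -> F^o).
Proof. exact: tlift_linear. Qed.

Lemma tcoef_pure x y k l : tcoef (x ⊗ y) k l = x k * y l.
Proof. exact: (tlift_pure (coef_bilin k l)). Qed.

(** The coordinate matrix underlying [tens] refers to an unspecified basis of
    the group algebra; this lemma gives access to the canonical one. *)
Lemma tens_galg_sum z : z = \sum_k \sum_l tcoef z k l *: (lam k ⊗ lam l).
Proof.
rewrite pair_bigA /=.
elim/tens_ind: z => [|z z' {1}-> {1}->|x y].
- rewrite big1 // => p _.
  by rewrite (_ : tcoef 0 _ _ = 0) ?scale0r // /tcoef /tlift big1 // => i _;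
     rewrite big1 // => j _; rewrite mxE scale0r.
- rewrite -big_split; apply: eq_bigr => p _ /=.
  by have := tcoef_linear p.1 p.2 1 z z'; rewrite !scale1r => ->; rewrite scalerDl.
have [tl tr] := tpure_bilin A A.
rewrite {1}[x]galg_sum (linear_sum_scale _ _ _ (tl y)).
rewrite -(pair_bigA _ (fun k l => tcoef (x ⊗ y) k l *: (lam k ⊗ lam l))) /=.
apply: eq_bigr => k _; rewrite {1}[y]galg_sum (linear_sum_scale _ _ _ (tr _)).
rewrite scaler_sumr.
by apply: eq_bigr => l _; rewrite tcoef_pure scalerA.
Qed.

Lemma tlift_coef (V : lmodType F) (b : A -> A -> V) z :
  bilin b -> tlift b z = \sum_k \sum_l tcoef z k l *: b (lam k) (lam l).
Proof.
move=> bb; rewrite {1}[z]tens_galg_sum !pair_bigA.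
rewrite (linear_sum_scale _ _ _ (tlift_linear b)).
by apply: eq_bigr => p _; rewrite tlift_pure.
Qed.

Lemma tcoef_inj z w : tcoef z =2 tcoef w -> z = w.
Proof.
move=> E; rewrite [z]tens_galg_sum [w]tens_galg_sum.
by apply: eq_bigr => k _; apply: eq_bigr => l _; rewrite E.
Qed.

Lemma tcoefD z w k l : tcoef (z + w) k l = tcoef z k l + tcoef w k l.
Proof. by have := tcoef_linear k l 1 z w; rewrite !scale1r. Qed.

Lemma tcoefZ a z k l : tcoef (a *: z) k l = a * tcoef z k l.
Proof.
have := tcoef_linear k l a z 0; rewrite addr0 => ->.
have := tcoef_linear k l (-1) 0 0.
by rewrite scaler0 addr0 scaleN1r addNr => ->; rewrite addr0.
Qed.

Lemma tcoef0 k l : tcoef 0 k l = 0.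
Proof. by rewrite -(scale0r 0) tcoefZ mul0r. Qed.

Lemma tcoef_flip z k l : tcoef (tflip z) k l = tcoef z l k.
Proof.
rewrite (linear_tlift _ _ (tcoef_linear k l)).
by apply: (@eq_tlift _ _ F^o) => x y; rewrite tcoef_pure mulrC.
Qed.

Lemma tpureM x y x' y' : (x ⊗ y) * (x' ⊗ y') = (x * x') ⊗ (y * y').
Proof. exact: tmul_pure. Qed.

Lemma tcoefM z w k l :
  tcoef (z * w) k l
  = \sum_a \sum_b tcoef z a b * tcoef w (a^-1 * k)%g (b^-1 * l)%g.
Proof.
elim/tens_ind: z => [|z z' Ez Ez'|x y].
- rewrite mul0r tcoef0 big1 // => a _; rewrite big1 // => b _.
  by rewrite tcoef0 mul0r.
- rewrite mulrDl tcoefD Ez Ez' -big_split; apply: eq_bigr => a _ /=.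
  by rewrite -big_split; apply: eq_bigr => b _; rewrite tcoefD mulrDl.
elim/tens_ind: w => [|w w' Ew Ew'|x' y'].
- rewrite mulr0 tcoef0 big1 // => a _; rewrite big1 // => b _.
  by rewrite tcoef0 mulr0.
- rewrite mulrDr tcoefD Ew Ew' -big_split; apply: eq_bigr => a _ /=.
  by rewrite -big_split; apply: eq_bigr => b _; rewrite tcoefD mulrDr.
rewrite tpureM tcoef_pure !ffunE mulr_suml; apply: eq_bigr => a _.
by rewrite mulr_sumr; apply: eq_bigr => b _; rewrite !tcoef_pure mulrACA.
Qed.

Lemma tflipM z w : tflip (z * w) = tflip z * tflip w.
Proof.
apply: tcoef_inj => k l; rewrite tcoef_flip !tcoefM exchange_big.
by apply: eq_bigr => a _; apply: eq_bigr => b _; rewrite !tcoef_flip.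
Qed.

End Tensors.

(** * Hopf algebra axioms in coordinates *)

Section Coordinates.
Variables (C : numClosedFieldType) (gT : finGroupType).
Local Notation A := (galg C gT).
Local Notation lam := (@glambda C gT).

Lemma tcoef_star (z : tens A A) k l :
  tcoef (tstar (@gstar C gT) z) k l = (tcoef z k^-1%g l^-1%g)^*.
Proof.
rewrite /tstar pair_bigA (linear_sum_scale _ _ _ (tcoef_linear k l)) /=.
rewrite [in RHS]/tcoef [in RHS]/tlift pair_bigA rmorph_sum.
apply: eq_bigr => p _ /=.
by rewrite tcoef_pure !ffunE !rmorphM.
Qed.

Lemma coassoc_coef (D : {linear A -> tens A A}) g k l n :
  tassoc (tmap D idfun (D (lam g))) = tmap idfun D (D (lam g)) ->
  \sum_m tcoef (D (lam g)) m n * tcoef (D (lam m)) k l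
  = \sum_m tcoef (D (lam g)) k m * tcoef (D (lam m)) l n.
Proof.
(* T reads off the coefficient of lambda k ⊗ (lambda l ⊗ lambda n). *)
pose T := tlift (fun (x : A) (w : tens A A) => x k * tcoef w l n : C^o).
have Tbilin : bilin (fun (x : A) (w : tens A A) => x k * tcoef w l n : C^o).
  split=> [w a x x'|x a w w']; first by rewrite !ffunE mulrDl -scalerAl.
  by rewrite tcoefD tcoefZ mulrDr mulrCA.
have Tlin : linear T by exact: tlift_linear.
have Sbilin : bilin (fun (w : tens A A) (y : A) => tcoef w k l * y n : C^o).
  split=> [y a w w'|w a y y']; last by rewrite !ffunE mulrDr mulrCA.
  by rewrite tcoefD tcoefZ mulrDl -mulrA.
have T_tassoc t : T (tassoc t)
    = tlift (fun (w : tens A A) (y : A) => tcoef w k l * y n : C^o) t.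
  rewrite /tassoc (linear_tlift _ _ Tlin); apply: eq_tlift => w y.
  rewrite (linear_tlift _ _ Tlin) /tcoef.
  have lin : linear (( *%R^~ (y n)) : C^o -> C^o).
    by move=> a u v; rewrite mulrDl -mulrA.
  rewrite (_ : _ * _ = tlift (fun x x' : A => x k * x' l * y n : C^o) w).
    by apply: eq_tlift => x x'; rewrite /T tlift_pure // tcoef_pure mulrA.
  exact: (linear_tlift _ _ lin).
move/(congr1 T); rewrite T_tassoc.
rewrite /tmap (linear_tlift _ _ (tlift_linear _)) (linear_tlift _ _ Tlin).
under eq_tlift => x y do rewrite tlift_pure //.
under [X in _ = X -> _]eq_tlift => x y do rewrite /T tlift_pure //=.
rewrite !tlift_coef /=; last first.
- split=> [y a x x'|x a y y']; last by rewrite !ffunE mulrDr mulrCA.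
  by rewrite linearP tcoefD tcoefZ mulrDl -mulrA.
- split=> [y a x x'|x a y y']; first by rewrite !ffunE mulrDl -scalerAl.
  by rewrite linearP tcoefD tcoefZ mulrDr mulrCA.
move=> E; transitivity (\sum_m \sum_p
    tcoef (D (lam g)) m p * (tcoef (D (lam m)) k l * lam p n)).
  apply: eq_bigr => m _.
  rewrite (bigD1 n) //= ffunE eqxx mulr1 big1 ?addr0 // => p np.
  by rewrite ffunE eq_sym (negPf np) !mulr0.
rewrite [LHS]E exchange_big; apply: eq_bigr => m _.
rewrite (bigD1 k) //= ffunE eqxx mul1r big1 ?addr0 // => p np.
by rewrite ffunE eq_sym (negPf np) mul0r scaler0.
Qed.

Variable K : kac_algebra A.

Lemma counit_coef g l : (forall x, kcounit K x = gcounit x) ->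
  \sum_k tcoef (kcomul K (lam g)) k l = (g == l)%:R.
Proof.
move=> Ke; have /ffunP/(_ l) := kcounitl K (lam g); rewrite ffunE eq_sym => <-.
rewrite tlift_coef; last first.
  split=> [y a x x'|x a y y']; first by rewrite linearP scalerDl scalerA.
  by rewrite scalerDr !scalerA mulrC.
rewrite sum_ffunE; apply: eq_bigr => k _.
rewrite sum_ffunE (bigD1 l) //= !ffunE eqxx big1 ?addr0 => [|n nl].
  rewrite Ke /gcounit (bigD1 k) //= ffunE eqxx big1 ?addr0 => [|n nk].
    by rewrite scale1r [RHS]mulr1.
  by rewrite ffunE (negPf nk).
by rewrite !ffunE eq_sym (negPf nl) !scaler0.
Qed.

(** The counit axiom forces x to have counit 1, and then the antipode axiom
    reads S(x) x = x S(x) = 1. *)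
Lemma grouplike_unit (x : A) : x != 0 -> kcomul K x = x ⊗ x ->
  x \is a GRing.unit.
Proof.
move=> x0 Dx.
have e1 : kcounit K x = 1.
  have := kcounitl K x; rewrite Dx tlift_pure; last first.
    split=> [z a y y'|y a z z']; first by rewrite linearP scalerDl scalerA.
    by rewrite scalerDr !scalerA mulrC.
  move/eqP; rewrite -[X in _ == X]scale1r -subr_eq0 -scalerBl scaler_eq0.
  by rewrite (negPf x0) orbF subr_eq0 => /eqP.
apply/unitrP; exists (kantipode K x); split.
  have := kantipodel K x; rewrite Dx tlift_pure ?e1 ?scale1r //.
  split=> [z a y y'|y a z z']; first by rewrite linearP mulrDl scalerAl.
  by rewrite mulrDr scalerAr.
have := kantipoder K x; rewrite Dx tlift_pure ?e1 ?scale1r //.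
split=> [z a y y'|y a z z']; first by rewrite mulrDl scalerAl.
by rewrite linearP mulrDr scalerAr.
Qed.

End Coordinates.

(** * Supports *)

Section Supports.
Variables (F : fieldType) (gT : finGroupType).
Local Notation A := (galg F gT).
Local Notation lam := (@glambda F gT).

Lemma span_ind (V : vectType F) (P : V -> Prop) (s : seq V) :
  P 0 -> (forall a u v, P u -> P v -> P (a *: u + v)) ->
  {in s, forall u, P u} -> {in <<s>>%VS, forall u, P u}.
Proof.
move=> P0 PD Ps u us; rewrite (coord_span (X := in_tuple s) us).
apply: (big_ind P) => // [v w Pv Pw|i _]; first by rewrite -[v]scale1r; apply: PD.
by rewrite -[_ *: _]addr0; apply: PD => //; apply/Ps/mem_nth/ltn_ord.
Qed.

Definition supported (S : {set gT}) (z : tens A A) :=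
  forall k l, tcoef z k l != 0 -> (k \in S) && (l \in S).

Lemma supported_galg2_on S z : z \in galg2_on F S -> supported S z.
Proof.
move: z.
apply: span_ind => [k l|a u v Su Sv k l|_ /allpairsP[[g h] /= [gS hS ->]] k l].
- by rewrite tcoef0 eqxx.
- rewrite tcoefD tcoefZ; have [v0|/Sv->//] := eqVneq (tcoef v k l) 0.
  by rewrite v0 addr0 mulf_eq0 => /norP[_ /Su].
rewrite !mem_enum in gS hS.
rewrite tcoef_pure !ffunE; case: (k =P g) => [->|_]; last by rewrite mul0r eqxx.
by case: (l =P h) => [->|_]; rewrite ?gS // mulr0 eqxx.
Qed.

Lemma galg2_on_supported S z : supported S z -> z \in galg2_on F S.
Proof.
move=> Sz; rewrite [z]tens_galg_sum.
apply: memv_suml => k _; apply: memv_suml => l _.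
have [->|/Sz/andP[kS lS]] := eqVneq (tcoef z k l) 0.
  by rewrite scale0r mem0v.
by apply/memvZ/memv_span/allpairs_f; rewrite mem_enum.
Qed.

Lemma supportedM (S T : {set gT}) z w :
  supported S z -> supported T w -> supported (S * T)%g (z * w).
Proof.
move=> Sz Tw k l; rewrite tcoefM; apply: contraNT => kl.
rewrite big1 // => a _; rewrite big1 // => b _; apply: contraNeq kl.
rewrite mulf_eq0 => /norP[/Sz/andP[aS bS] /Tw/andP[kT lT]].
by rewrite -[k](mulKVg a) -[l](mulKVg b) !mem_mulg.
Qed.

Lemma gcomul_lam g : gcomul (lam g) = lam g ⊗ lam g.
Proof.
rewrite /gcomul (bigD1 g) //= ffunE eqxx scale1r big1 ?addr0 // => h nh.
by rewrite ffunE (negPf nh) scale0r.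
Qed.

Lemma supported_gcomul_lam g : supported [set g] (gcomul (lam g)).
Proof.
move=> k l; rewrite gcomul_lam tcoef_pure !ffunE !inE mulf_eq0.
by case: (k == g); case: (l == g); rewrite ?eqxx ?orbT.
Qed.

Lemma galg_onP (S : {set gT}) (x : A) :
  reflect (forall g, x g != 0 -> g \in S) (x \in galg_on F S).
Proof.
apply: (iffP idP) => [|xS].
  move: x; apply: span_ind => [g|a u v Pu Pv g|_ /mapP[h hS ->] g].
  - by rewrite ffunE eqxx.
  - rewrite !ffunE; have [v0|/Pv->//] := eqVneq (v g) 0.
    by rewrite v0 addr0 mulf_eq0 => /norP[_ /Pu].
  - by rewrite ffunE; case: (g =P h) => [->|_]; rewrite -?(mem_enum S) ?eqxx.
rewrite [x]galg_sum; apply: memv_suml => g _.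
have [->|/xS gS] := eqVneq (x g) 0; first by rewrite scale0r mem0v.
by apply/memvZ/memv_span/map_f; rewrite mem_enum.
Qed.

Lemma glambda_unit g : lam g \is a GRing.unit.
Proof.
by apply/unitrP; exists (lam g^-1%g); rewrite !glambdaM mulVg mulgV.
Qed.

End Supports.

Lemma sum_subg (gT : finGroupType) (V : nmodType) (G : {group gT})
    (f : gT -> V) :
  (forall g, f g != 0 -> g \in G) ->
  \sum_(g : subg_of G) f (sgval g) = \sum_g f g.
Proof.
move=> fG; rewrite [RHS](bigID (mem G)) /= [X in _ = _ + X]big1 => [|g gG].
  rewrite addr0 (reindex_onto sgval (subg G)) /=; last exact: subgK.
  by apply: eq_bigl => g; rewrite sgvalK eqxx subgP.
by apply: contraNeq gG => /fG.
Qed.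

(** * The twisted Kac algebra *)

Section Twist.
Variables (C : numClosedFieldType) (gT : finGroupType) (H : {group gT}).
Local Notation A := (galg C gT).
Local Notation lam := (@glambda C gT).
Variables (Omega : tens A A) (K : kac_algebra A).
Hypotheses (abH : abelian H) (twK : twisting H Omega K).
Local Notation c g k l := (tcoef (kcomul K (lam g)) k l).
Let Omega_star := tstar (@gstar C gT) Omega.

Lemma supported_Omega : supported H Omega.
Proof. exact/supported_galg2_on/(twist_in twK). Qed.

Lemma supported_Omega_star : supported H Omega_star.
Proof.
move=> k l; rewrite tcoef_star conjC_eq0 => /supported_Omega.
by rewrite !groupV.
Qed.

Lemma comul_double_coset g : supported (H * [set g] * H)%g (kcomul K (lam g)).
Proof.
rewrite (twist_comul twK); apply: supportedM; last exact: supported_Omega_star.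
by apply: supportedM; [exact: supported_Omega|exact: supported_gcomul_lam].
Qed.

Lemma comul_lam_in h : h \in H -> kcomul K (lam h) = lam h ⊗ lam h.
Proof.
move=> hH; rewrite (twist_comul twK) gcomul_lam.
have -> : Omega * (lam h ⊗ lam h) = (lam h ⊗ lam h) * Omega.
  move: Omega (twist_in twK).
  apply: span_ind => [|a u v Eu Ev|_ /allpairsP[[k l] /= [kH lH ->]]].
  - by rewrite mul0r mulr0.
  - by rewrite mulrDl mulrDr -scalerAl -scalerAr Eu Ev.
  rewrite !mem_enum in kH lH.
  rewrite !tpureM !glambdaM.
  have [-> ->] : (k * h = h * k /\ l * h = h * l)%g.
    by split; exact: (centsP abH).
  by [].
by rewrite -mulrA (twist_unitaryr twK) mulr1.
Qed.

Lemma intrinsic_lam h : h \in H -> intrinsic_group K (lam h).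
Proof. by move=> hH; split; [exact: glambda_unit|exact: comul_lam_in]. Qed.

Definition cocommutative_at (x : A) := tflip (kcomul K x) = kcomul K x.

Lemma cocommutative_at_lc a x y :
  cocommutative_at x -> cocommutative_at y -> cocommutative_at (a *: x + y).
Proof.
move=> Ex Ey; rewrite /cocommutative_at linearP /= -{2}Ex -{2}Ey.
exact: tlift_linear.
Qed.

Lemma cocommutative_at0 : cocommutative_at 0.
Proof.
rewrite /cocommutative_at raddf0; apply: tcoef_inj => k l.
by rewrite tcoef_flip !tcoef0.
Qed.

Lemma cocommutative_atZ a x : cocommutative_at x -> cocommutative_at (a *: x).
Proof.
by move=> Ex; rewrite -[a *: x]addr0; apply/cocommutative_at_lc/cocommutative_at0.
Qed.

Lemma cocommutative_at_grouplike x :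
  kcomul K x = x ⊗ x -> cocommutative_at x.
Proof. by rewrite /cocommutative_at => ->; rewrite tflip_pure. Qed.

Lemma comul_coefM g g' k l :
  c (g * g')%g k l = \sum_a \sum_b c g a b * c g' (a^-1 * k)%g (b^-1 * l)%g.
Proof. by rewrite -glambdaM rmorphM tcoefM. Qed.

Lemma comul_coef_star g k l : (c g k l)^* = c g^-1%g k^-1%g l^-1%g.
Proof.
have -> : lam g^-1 = kstar K (lam g).
  rewrite (twist_star twK); apply/ffunP => n; rewrite !ffunE rmorph_nat.
  by rewrite (can2_eq invgK invgK).
rewrite kcomul_star.
have -> : tstar (kstar K) (kcomul K (lam g))
          = tstar (@gstar C gT) (kcomul K (lam g)).
  rewrite /tstar; apply: eq_bigr => i _; apply: eq_bigr => j _.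
  by rewrite !(twist_star twK).
by rewrite tcoef_star !invgK.
Qed.

(** The trace of C[G] stays invariant under the twisted coproduct: 1 occurs in
    the double coset H g H only if g is in H, and there the twist is trivial. *)
Lemma haar_coef g l : c g 1%g l = ((g == 1%g) && (l == 1%g))%:R.
Proof.
have [gH|gNH] := boolP (g \in H).
  rewrite comul_lam_in // tcoef_pure !ffunE eq_sym.
  by have [->|_] := eqVneq g 1%g; rewrite ?mul1r ?mul0r.
have -> : (g == 1%g) = false by apply: contraNF gNH => /eqP->.
apply/eqP; apply: contraNT gNH => /comul_double_coset/andP[+ _].
case/mulsgP=> _ b /mulsgP[a _ aH /set1P-> ->] bH E.
have -> : g = (a^-1 * b^-1)%g by rewrite -[b^-1%g]mul1g E mulgK mulKg.
by rewrite groupM ?groupV.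
Qed.

Lemma mem_symmetric_part g :
  (g \in symmetric_part K) <-> cocommutative_at (lam g).
Proof. by rewrite inE; split=> /eqP. Qed.

Lemma symmetric_part_group : group_set (symmetric_part K).
Proof.
apply/group_setP; split=> [|g h /mem_symmetric_part Eg /mem_symmetric_part Eh];
  apply/mem_symmetric_part.
  by apply: cocommutative_at_grouplike; apply: comul_lam_in.
by rewrite /cocommutative_at -glambdaM rmorphM tflipM Eg Eh.
Qed.

(** With [slice] the map y ⊗ z |-> y(g) z, the slice of the untwisted coproduct
    of x is x(g) lambda(g), whereas the slice of Omega^* (x ⊗ x) Omega is a
    combination of the group-likes lambda(l) x lambda(n) with l and n in H. *)
Lemma grouplike_supported x :
  kcomul K x = x ⊗ x -> x \in galg_on C (symmetric_part K).
Proof.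
move=> Dx; apply/galg_onP => g xg0; apply/mem_symmetric_part.
have gx : gcomul x = Omega_star * (x ⊗ x) * Omega.
  rewrite -Dx (twist_comul twK) !mulrA (twist_unitaryl twK) mul1r.
  by rewrite -mulrA (twist_unitaryl twK) mulr1.
pose slice := tlift (fun y z : A => y g *: z).
have bslice : bilin (fun y z : A => y g *: z).
  split=> [z a y y'|y a z z']; first by rewrite !ffunE scalerDl scalerA.
  by rewrite scalerDr !scalerA mulrC.
have lslice : linear slice by exact: tlift_linear.
have slice0 : slice 0 = 0.
  by have := lslice (-1) 0 0; rewrite scaler0 addr0 scaleN1r addNr.
have slice_cocomm : {in galg2_on C H &, forall z w,
    cocommutative_at (slice (z * (x ⊗ x) * w))}.
  move=> z w zH wH; move: z zH.
  apply: span_ind => [|a u v Pu Pv|_ /allpairsP[[k l] /= [_ lH ->]]].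
  - by rewrite !mul0r slice0; apply: cocommutative_at0.
  - by rewrite !mulrDl -!scalerAl lslice; apply: cocommutative_at_lc.
  move: w wH; apply: span_ind => [|a u v Pu Pv|_ /allpairsP[[m n] /= [_ nH ->]]].
  - by rewrite !mulr0 slice0; apply: cocommutative_at0.
  - by rewrite !mulrDr -!scalerAr lslice; apply: cocommutative_at_lc.
  rewrite !mem_enum in lH nH.
  rewrite !tpureM /slice tlift_pure //.
  apply: cocommutative_atZ; apply: cocommutative_at_grouplike.
  by rewrite !rmorphM /= !comul_lam_in // Dx !tpureM.
have := slice_cocomm _ _ (galg2_on_supported supported_Omega_star)
                     (twist_in twK).
rewrite -gx /gcomul (linear_sum_scale _ _ _ lslice).
rewrite (bigD1 g) //= big1 ?addr0 => [|h nh]; rewrite /slice tlift_pure //.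
  rewrite ffunE eqxx scale1r => /(cocommutative_atZ (x g)^-1).
  by rewrite scalerA mulVf // scale1r.
by rewrite ffunE eq_sym (negPf nh) scale0r scaler0.
Qed.

Let Gs := Group symmetric_part_group.

Lemma comul_symmetric_support g k l :
  g \in Gs -> c g k l != 0 -> (k \in Gs) && (l \in Gs).
Proof.
move=> gS /comul_double_coset.
suff /subsetP sub : (H * [set g] * H)%g \subset Gs by move=> /andP[/sub-> /sub->].
have HS : H \subset Gs.
  apply/subsetP => h hH; apply/mem_symmetric_part.
  by apply: cocommutative_at_grouplike; apply: comul_lam_in.
by rewrite !mul_subG // sub1set.
Qed.

(** The coproduct restricts to a cocommutative one on C[G'], whose group-likes
    are extended by 0 to elements of C[G]. *)
Lemma symmetric_part_spanned :
  exists2 s : seq A, {in s, forall y, intrinsic_group K y}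
                   & forall h, h \in symmetric_part K -> lam h \in <<s>>%VS.
Proof.
pose cS (g k l : subg_of Gs) := c (sgval g) (sgval k) (sgval l).
have csym g' k l : g' \in Gs -> c g' k l = c g' l k.
  by move=> /mem_symmetric_part E; rewrite -[in LHS]E tcoef_flip.
have sgin (g' : subg_of Gs) : sgval g' \in Gs by exact: subgP.
have csupp (a : subg_of Gs) k l :
    c (sgval a) k l != 0 -> (k \in Gs) && (l \in Gs).
  exact: comul_symmetric_support (sgin a).
have [||||||w [w1 wD wspan]] := @grouplikes_span C (subg_of Gs) cS.
- move=> a k l n; rewrite /cS.
  rewrite (sum_subg
    (f := fun m => c (sgval a) m (sgval n) * c m (sgval k) (sgval l))); last first.
    by move=> m; rewrite mulf_eq0 => /norP[/(csupp a)/andP[]].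
  rewrite (sum_subg
    (f := fun m => c (sgval a) (sgval k) m * c m (sgval l) (sgval n))); last first.
    by move=> m; rewrite mulf_eq0 => /norP[/(csupp a)/andP[]].
  by apply: coassoc_coef; exact: kcomulA.
- by move=> a k l; apply: csym.
- move=> a l; rewrite /cS (sum_subg (f := fun k => c (sgval a) k (sgval l))).
    by rewrite counit_coef ?(inj_eq subg_inj) //; exact: (twist_counit twK).
  by move=> k /(csupp a)/andP[].
- move=> a b k l; rewrite /cS /= comul_coefM.
  rewrite -(@sum_subg _ _ Gs) => [|m].
    apply: eq_bigr => m _; rewrite -(@sum_subg _ _ Gs) // => n.
    by rewrite mulf_eq0 => /norP[/(csupp a)/andP[]].
  apply: contraNT => mG; rewrite big1 // => n _.
  apply/eqP; rewrite mulf_eq0; apply/orP; left; apply: contraNT mG.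
  by case/(csupp a)/andP.
- by move=> a k l; apply: comul_coef_star.
- by move=> a l; rewrite /cS haar_coef -!(inj_eq subg_inj).
pose v i : A := [ffun g => if g \in Gs then w i (subg Gs g) else 0].
have vE i (k : subg_of Gs) : v i (sgval k) = w i k by rewrite ffunE sgin sgvalK.
have v0 i k : k \notin Gs -> v i k = 0 by move=> /negPf kG; rewrite ffunE kG.
have vsum i : v i = \sum_(g : subg_of Gs) w i g *: lam (sgval g).
  rewrite [LHS]galg_sum -(@sum_subg _ _ Gs (fun g => v i g *: lam g)).
    by apply: eq_bigr => k _; rewrite vE.
  by move=> k; apply: contraNT => /v0->; rewrite scale0r.
have subK k : k \in Gs -> sgval (subg Gs k) = k by exact: subgK.
have vD i : kcomul K (v i) = v i ⊗ v i.
  apply: tcoef_inj => k l; rewrite tcoef_pure.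
  have lin : linear (fun x => tcoef (kcomul K x) k l : C^o).
    by move=> a x y; rewrite linearP tcoefD tcoefZ.
  transitivity (\sum_(g : subg_of Gs) w i g * c (sgval g) k l).
    by rewrite {1}vsum; exact: (linear_sum_scale _ _ _ lin).
  have [/andP[kG lG]|klG] := boolP ((k \in Gs) && (l \in Gs)).
    by rewrite -(subK _ kG) -(subK _ lG) !vE -wD.
  rewrite big1 => [|g _].
    by have [/v0->|/v0->] := nandP klG; rewrite ?mul0r ?mulr0.
  have /eqP-> : c (sgval g) k l == 0.
    by apply: contraNT klG; exact: csupp g k l.
  by rewrite mulr0.
exists [seq v j | j <- enum 'I_#|subg_of Gs|].
  move=> _ /mapP[i _ ->]; split=> //; apply: grouplike_unit (vD i).
  apply/eqP => vi0; have /eqP := w1 i; rewrite big1 ?(eq_sym 0) ?oner_eq0 // => k _.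
  by rewrite -vE vi0 ffunE.
move=> h hG; have [q hq] := wspan (subg Gs h).
have -> : lam h = \sum_i q i *: v i.
  apply/ffunP => k; rewrite sum_ffunE ffunE.
  under eq_bigr do rewrite ffunE.
  have [kG|kNG] := boolP (k \in Gs).
    rewrite -(subK _ kG) -[h in LHS](subK _ hG) (inj_eq subg_inj) hq.
    by apply: eq_bigr => i _; rewrite vE.
  rewrite big1 => [|i _]; last by rewrite v0 // scaler0.
  by case: eqP kNG => // ->; rewrite hG.
by apply: memv_suml => i _; apply/memvZ/memv_span/map_f; rewrite mem_enum.
Qed.

End Twist.

Theorem corollary5p4p1 (R : realType) (gT : finGroupType) (H : {group gT})
    (Omega : tens (galg R[i] gT) (galg R[i] gT))
    (K : kac_algebra (galg R[i] gT)) :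
  abelian H -> twisting H Omega K ->
  [/\ forall h, h \in H -> intrinsic_group K (glambda R[i] h),
      group_set (symmetric_part K)
    & forall x : galg R[i] gT,
        in_span (intrinsic_group K) x
          <-> x \in galg_on R[i] (symmetric_part K)].
Proof.
move=> abH twK; split.
- exact: intrinsic_lam abH twK.
- exact: symmetric_part_group abH twK.
move=> x; split=> [[s sK]|xS].
  apply/subvP/span_subvP => y /sK[_ Dy].
  exact: grouplike_supported abH twK _ Dy.
have [s sK sS] := symmetric_part_spanned abH twK.
exists s => //; move: x xS; apply/subvP/span_subvP => _ /mapP[g gS ->].
by apply: sS; rewrite -mem_enum.
Qed.
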